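(* Let $\mathbb{F}$ be a field, and let $K$ and $L$ be finite simplicial complexes (on disjoint vertex sets). (i) If $L$ is taut over $\mathbb{F}$, then $K$ is taut over $\mathbb{F}$ if and only if $K*L$ is taut over $\mathbb{F}$. (ii) If $L$ is weakly taut over $\mathbb{F}$, then $K$ is weakly taut over $\mathbb{F}$ if and only if $K*L$ is weakly taut over $\mathbb{F}$. In particular, for every $r\ge 1$, $K$ is taut (respectively weakly taut) over $\mathbb{F}$ if and only if $K*\Delta^{[r]}$ is taut (respectively weakly taut) over $\mathbb{F}$.
   Context: A finite simplicial complex $K$ with vertex set $V(K)=[m]=\{v_1,\dots,v_m\}$ contains $\varnothing$ and every singleton $\{v_i\}$ as a face. $*$ is the join of simplicial complexes and $\Delta^{[r]}$ is the $(r-1)$-simplex on $r$ vertices. The dimension of a face $\sigma$ is $|\sigma|-1$; $\mathrm{mdim}(K)$ is the minimal dimension of the maximal simplices of $K$. $\widetilde{D}(K;\mathbb{F})=\dim_{\mathbb{F}}\mathrm{Tor}_{\mathbb{F}[v_1,\dots,v_m]}(\mathbb{F}[K],\mathbb{F})$, where $\mathbb{F}[K]$ is the Stanley-Reisner ring; equivalently (Hochster's formula) $\widetilde{D}(K;\mathbb{F})=\sum_{J\subseteq V(K)}\sum_{i\ge -1}\dim_{\mathbb{F}}\widetilde{H}_i(K|_J;\mathbb{F})$, where $K|_J$ is the full subcomplex on $J$ and $\widetilde{H}_{-1}(\{\varnothing\};\mathbb{F})=\mathbb{F}$ is the only nonzero reduced homology group of $\{\varnothing\}$. $K$ with $m$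 vertices is taut over $\mathbb{F}$ if $\widetilde{D}(K;\mathbb{F})=2^{m-\dim(K)-1}$ and weakly taut over $\mathbb{F}$ if $\widetilde{D}(K;\mathbb{F})=2^{m-\mathrm{mdim}(K)-1}$. *)

(* Defs.v *)
From HB Require Import structures.
From mathcomp Require Import all_boot all_order all_algebra.

Set Implicit Arguments.
Unset Strict Implicit.
Unset Printing Implicit Defensive.

Import GRing.Theory.
Local Open Scope ring_scope.

Record complex (T : finType) := Complex {
  faces :> {set {set T}};
  complex_set0 : set0 \in faces;
  complex_set1 : forall x : T, [set x] \in faces;
  complex_sub : forall s t : {set T}, t \in faces -> s \subset t -> s \in faces
}.

Section Join.

Variables T U : finType.

(* Disjointness of the vertex sets is realized by the sum type [T + U]. *)
Definition join_faces (K : {set {set T}}) (L : {set {set U}}) :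
    {set {set T + U}} :=
  [set inl @: s :|: inr @: t | s : {set T} in K, t : {set U} in L].

Variables (K : complex T) (L : complex U).

Fact sjoin_set0 : set0 \in join_faces K L.
Proof.
apply/imset2P; exists set0 set0; rewrite ?complex_set0 //.
by rewrite !imset0 setU0.
Qed.

Fact sjoin_set1 (x : T + U) : [set x] \in join_faces K L.
Proof.
apply/imset2P; case: x => x.
  exists [set x] set0; rewrite ?complex_set1 ?complex_set0 //.
  by rewrite imset0 setU0 imset_set1.
exists set0 [set x]; rewrite ?complex_set1 ?complex_set0 //.
by rewrite imset0 set0U imset_set1.
Qed.

Fact sjoin_sub (s t : {set T + U}) :
  t \in join_faces K L -> s \subset t -> s \in join_faces K L.
Proof.
case/imset2P=> a b aK bL -> /subsetP sab; apply/imset2P.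
exists (inl @^-1: s) (inr @^-1: s).
- apply: complex_sub aK _; apply/subsetP=> x; rewrite inE => /sab.
  by case/setUP=> /imsetP[y ya] // [->].
- apply: complex_sub bL _; apply/subsetP=> x; rewrite inE => /sab.
  by case/setUP=> /imsetP[y ya] // [->].
apply/setP=> x; apply/idP/setUP => [xs|].
  by case: x xs => x xs; [left | right]; apply/imsetP; exists x; rewrite ?inE.
by case=> /imsetP[y]; rewrite inE => ys ->.
Qed.

Definition sjoin : complex (T + U)%type :=
  Complex sjoin_set0 sjoin_set1 sjoin_sub.

End Join.

Definition simplex (r : nat) : complex 'I_r :=
  @Complex 'I_r setT (in_setT _) (fun x => in_setT _)
    (fun s t _ _ => in_setT s).

Section Dimension.

Variables (T : finType) (K : complex T).

Definition sdim : int := (\max_(s in faces K) #|s|)%N%:Z - 1.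

Definition facets : {set {set T}} := [set s | maxset (mem (faces K)) s].

(* The default value [#|T|] is harmless: there is at least one facet, and a
   facet has at most [#|T|] vertices. *)
Definition mdim : int := (\big[minn/#|T|]_(s in facets) #|s|)%N%:Z - 1.

End Dimension.

Section ReducedHomology.

Variables (F : fieldType) (T : finType).

(* The vector space with basis all subsets of [T]. *)
Definition chain := {ffun {set T} -> F^o}.

Definition basis_chain (s : {set T}) : chain := [ffun t => (t == s)%:R].

(* Simplices are oriented by the enumeration order of [T]. *)
Definition face_pos (s : {set T}) (x : T) : nat :=
  #|[set y in s | (enum_rank y < enum_rank x)%N]|.

Definition boundary_fun (c : chain) : chain :=
  \sum_(s : {set T})
    c s *: \sum_(x in s) (-1) ^+ face_pos s x *: basis_chain (s :\ x).

Fact boundary_fun_is_linear : linear boundary_fun.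
Proof.
move=> a c d; rewrite /boundary_fun scaler_sumr -big_split /=.
by apply: eq_bigr => s _; rewrite !ffunE scalerDl scalerA.
Qed.

HB.instance Definition _ :=
  GRing.isLinear.Build F chain chain *:%R boundary_fun boundary_fun_is_linear.

Definition boundary : 'End(chain) := linfun boundary_fun.

(* Chains are graded by the number [k] of vertices, so degree [k] is spanned by
   the faces of dimension [k - 1], and [k = 0] is the augmentation degree. *)
Definition chains (K : {set {set T}}) (k : nat) : {vspace chain} :=
  <<[seq basis_chain s | s : {set T} in [set s in K | #|s| == k]]>>%VS.

Definition cycles (K : {set {set T}}) (k : nat) : {vspace chain} :=
  (chains K k :&: lker boundary)%VS.

Definition boundaries (K : {set {set T}}) (k : nat) : {vspace chain} :=
  (boundary @: chains K k.+1)%VS.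

(* The dimension of the reduced homology of [K] in degree [k - 1]. *)
Definition rbetti (K : {set {set T}}) (k : nat) : nat :=
  (\dim (cycles K k) - \dim (boundaries K k))%N.

End ReducedHomology.

Definition full_subcomplex (T : finType) (K : {set {set T}}) (J : {set T}) :
    {set {set T}} :=
  [set s in K | s \subset J].

(* The total dimension of Tor of the Stanley-Reisner ring of [K], in the form
   given by Hochster's formula; homology vanishes in degrees [>= #|T|]. *)
Definition Dtilde (F : fieldType) (T : finType) (K : complex T) : nat :=
  (\sum_(J : {set T}) \sum_(k < #|T|.+1) rbetti F (full_subcomplex K J) k)%N.

Definition taut (F : fieldType) (T : finType) (K : complex T) : Prop :=
  (Dtilde F K)%:R = 2%:R ^ (#|T|%:Z - sdim K - 1) :> rat.

Definition weakly_taut (F : fieldType) (T : finType) (K : complex T) : Prop :=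
  (Dtilde F K)%:R = 2%:R ^ (#|T|%:Z - mdim K - 1) :> rat.

(* Main.v *)
(* Hochster's sum for a join splits over pairs of vertex subsets, so everything
   reduces to a Kuenneth formula for the total reduced homology of a join: then
   [Dtilde] is multiplicative, while dimensions plus one are additive, and the
   exponents of 2 match.  For a square-zero matrix [A] of size [n] the total
   homology has dimension [n - 2 rank A], and this is the rank of the projector
   [1 - (A H + H A)] for any suitable homotopy [H].  Listing the faces of a join
   as pairs, its boundary matrix is [A (x) 1 + E (x) B] with [E] the sign
   [(-1)^#|s|]; a homotopy for it is built from homotopies for [A] and [B] whose
   projector is the tensor product of the two projectors, and ranks multiply.
   A full simplex is a cone on every nonempty vertex subset, hence taut. *)
Require Import Defs.
From HB Require Import structures.
From mathcomp Require Import all_boot all_order all_algebra.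
From mathcomp Require Import mxtens ring.

Set Implicit Arguments.
Unset Strict Implicit.
Unset Printing Implicit Defensive.

Import GRing.Theory.
Local Open Scope ring_scope.

(** * Tensor products of matrices and their ranks *)

Lemma tensmx11 (R : pzRingType) m n :
  1%:M *t 1%:M = 1%:M :> 'M[R]_(m * n).
Proof.
apply/matrixP=> i j; case: (mxtens_indexP i) => a b.
case: (mxtens_indexP j) => c d; rewrite tensmxE !mxE.
rewrite (can_eq (@mxtens_indexK _ _)) xpair_eqE.
by case: eqP; case: eqP; rewrite ?(mulr1, mulr0, mul0r).
Qed.

Lemma tensmxBl (R : pzRingType) m n p q (A B : 'M[R]_(m, n)) (C : 'M_(p, q)) :
  (A - B) *t C = A *t C - B *t C.
Proof. by apply/matrixP=> i j; rewrite !mxE mulrBl. Qed.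

Lemma tensmxDl (R : pzRingType) m n p q (A B : 'M[R]_(m, n)) (C : 'M_(p, q)) :
  (A + B) *t C = A *t C + B *t C.
Proof. by apply/matrixP=> i j; rewrite !mxE mulrDl. Qed.

Lemma tensmxBr (R : pzRingType) m n p q (A B : 'M[R]_(m, n)) (C : 'M_(p, q)) :
  C *t (A - B) = C *t A - C *t B.
Proof. by apply/matrixP=> i j; rewrite !mxE mulrBr. Qed.

Lemma tensmxDr (R : pzRingType) m n p q (A B : 'M[R]_(m, n)) (C : 'M_(p, q)) :
  C *t (A + B) = C *t A + C *t B.
Proof. by apply/matrixP=> i j; rewrite !mxE mulrDr. Qed.

(** Tensoring the rank factorizations of [A] and [B] bounds the rank from above. Conversely,
    one-sided inverses of the base factors compress [A *t B] to an identity matrix of size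
    [\rank A * \rank B]. *)
Lemma mxrank_tens (F : fieldType) m n p q (A : 'M[F]_(m, n)) (B : 'M_(p, q)) :
  \rank (A *t B) = (\rank A * \rank B)%N.
Proof.
apply/eqP; rewrite eqn_leq; apply/andP; split.
  rewrite -{1}(mulmx_base A) -{1}(mulmx_base B) -tensmx_mul.
  exact: leq_trans (mxrankM_maxl _ _) (rank_leq_col _).
have [A' rA'] := row_freeP (row_base_free A).
have [B' rB'] := row_freeP (row_base_free B).
have [A1 cA1] := row_fullP (col_base_full A).
have [B1 cB1] := row_fullP (col_base_full B).
have A11 : A1 *m A *m A' = 1%:M.
  by rewrite -[X in _ *m X *m _](mulmx_base A) mulmxA cA1 mul1mx.
have B11 : B1 *m B *m B' = 1%:M.
  by rewrite -[X in _ *m X *m _](mulmx_base B) mulmxA cB1 mul1mx.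
have: (A1 *t B1) *m (A *t B) *m (A' *t B') = 1%:M.
  by rewrite !tensmx_mul A11 B11 tensmx11.
move/(congr1 mxrank); rewrite mxrank1 => <-.
exact: leq_trans (mxrankM_maxl _ _) (mxrankM_maxr _ _).
Qed.

(** * Homotopies and the projectors they define *)

Definition hproj (R : pzRingType) n (A H : 'M[R]_n) := 1%:M - (A *m H + H *m A).

(** On row vectors, these equations make [hproj A H] an idempotent that kills the boundaries and
    takes values in the cycles: it projects onto a space of representatives of homology classes. *)
Definition contraction (R : pzRingType) n (A H : 'M[R]_n) :=
  [/\ A *m hproj A H = 0, hproj A H *m A = 0
    & hproj A H *m hproj A H = hproj A H].

(** The kernel of [A] is the direct sum of the row spaces of [A] and of the projector; rank-nullity
    then gives the count. *)
Lemma dim_contraction (F : fieldType) n (A H : 'M[F]_n) :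
  A *m A = 0 -> contraction A H -> n = (2 * \rank A + \rank (hproj A H))%N.
Proof.
move=> AA [AP PA PP]; set P := hproj A H in AP PA PP *.
have AHA : A *m H *m A = A.
  move: AP; rewrite /P /hproj mulmxBr mulmx1 mulmxDr !mulmxA AA mul0mx add0r.
  by move/eqP; rewrite subr_eq0 => /eqP <-.
have kerE : (kermx A == A + P)%MS.
  apply/andP; split.
    (* A vector [v] with [v A = 0] satisfies [v = v H A + v P]. *)
    have {1}-> : kermx A = kermx A *m H *m A + kermx A *m P.
      rewrite /P /hproj mulmxBr mulmx1 mulmxDr !mulmxA mulmx_ker mul0mx add0r.
      by rewrite addrC subrK.
    by apply: addmx_sub_adds; apply: submxMl.
  by rewrite addsmx_sub; apply/andP; split; apply/sub_kermxP.
(* A common vector is fixed by [P], being in its image, and killed by [P], being a boundary. *)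
have capE : (A :&: P = 0)%MS.
  apply/eqP; rewrite -submx0; apply/rV_subP => v.
  rewrite sub_capmx => /andP[/submxP[y ->] /submxP[z yz]].
  by rewrite yz -PP mulmxA -yz -mulmxA AP mulmx0 sub0mx.
have := mxrank_sum_cap A P.
rewrite capE mxrank0 addn0 -(eqmxP kerE) mxrank_ker.
by rewrite mul2n -addnn -addnA => <-; rewrite subnKC ?rank_leq_row.
Qed.

(** Here [E] is the grading involution, and anticommuting with it means being odd, as the
    differential [A] is. An odd [H] is what makes the mixed terms cancel in a tensor product. In
    characteristic 2, where averaging over [E] would divide by zero, [E = 1] and every matrix is
    odd. *)
Lemma contraction_exists (F : fieldType) n (A E : 'M[F]_n) :
    A *m A = 0 -> E *m E = 1%:M -> E *m A = - (A *m E) ->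
    (2%:R == 0 :> F -> E = 1%:M) ->
  exists2 H, contraction A H & E *m H = - (H *m E).
Proof.
move=> AA EE EA charE.
have [g AgA Eg] : exists2 g, A *m g *m A = A & E *m g = - (g *m E).
  have [g0 Ag0A] : exists g, A *m g *m A = A.
    by exists (pinvmx A); apply: mulmxKpV.
  (* Away from characteristic 2, antisymmetrize [g0] under conjugation by [E]. *)
  have [two0|two_neq0] := boolP (2%:R == 0 :> F).
    exists g0 => //; rewrite charE // mul1mx mulmx1; apply/eqP.
    by rewrite -addr_eq0 -mulr2n -scaler_nat (eqP two0) scale0r.
  exists (2%:R^-1 *: (g0 - E *m g0 *m E)).
    rewrite -scalemxAr -scalemxAl mulmxBr mulmxBl Ag0A.
    have -> : A *m (E *m g0 *m E) *m A = - A.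
      rewrite -!mulmxA EA !mulmxN !mulmxA -[A *m E]opprK -EA !mulNmx opprK.
      by rewrite -!(mulmxA E) Ag0A mulmxA EA mulNmx -mulmxA EE mulmx1.
    by rewrite opprK -mulr2n -scaler_nat scalerA mulVf // scale1r.
  rewrite -scalemxAr -scalemxAl mulmxBr mulmxBl !mulmxA EE mul1mx.
  by rewrite -(mulmxA _ E E) EE mulmx1 -scalerN opprB.
(* Subtracting [g g A] from a generalized inverse [g] of [A] gives [H] with
   [H H A = 0], which makes the projector idempotent. *)
exists (g - g *m g *m A); last first.
  rewrite mulmxBr mulmxBl !mulmxA Eg !mulNmx -(mulmxA g E g) Eg mulmxN.
  rewrite mulNmx opprK -!mulmxA EA !mulmxA !mulmxN opprB opprK addrC.
  by rewrite !mulmxA.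
set H := g - _.
have AH : A *m H *m A = A.
  by rewrite mulmxBr mulmxBl AgA -!mulmxA AA !mulmx0 subr0.
have HHA : H *m H *m A = 0.
  have HA : H *m A = g *m A by rewrite mulmxBl -!mulmxA AA !mulmx0 subr0.
  rewrite -mulmxA HA mulmxBl !mulmxA -(mulmxA (g *m g)) -(mulmxA (g *m g)).
  by rewrite AgA subrr.
have PA : hproj A H *m A = 0.
  by rewrite mulmxBl mulmxDl mul1mx AH -mulmxA AA mulmx0 addr0 subrr.
split=> //.
  by rewrite mulmxBr mulmxDr mulmx1 !mulmxA AH AA mul0mx add0r subrr.
(* Write [P] for the projector. As [P A = 0], idempotence amounts to [P H A = 0], which follows from
   [H H A = 0] and [A H A = A]. *)
rewrite {2}/hproj mulmxBr mulmx1 mulmxDr !mulmxA PA mul0mx add0r.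
have -> : hproj A H *m H *m A = 0; last by rewrite subr0.
rewrite -mulmxA /hproj mulmxBl mul1mx mulmxDl -(mulmxA A) (mulmxA H) HHA mulmx0.
by rewrite add0r -(mulmxA H) (mulmxA A) AH subrr.
Qed.

(** The homotopy [T] contracts the left factor and applies [G] only where the left projector [P]
    survives. In [D T + T D] the mixed terms [E H (x) B] and [H E (x) B] cancel, leaving
    [(1 - P) (x) 1 + P (x) (1 - Q)], that is [1 - P (x) Q], where [Q] is [hproj B G]. *)
Lemma contraction_tens (R : comPzRingType) m n (A E H : 'M[R]_m) (B G : 'M_n)
    (D := A *t 1%:M + E *t B) (T := H *t 1%:M + (hproj A H *m E) *t G) :
    E *m E = 1%:M -> E *m A = - (A *m E) -> E *m H = - (H *m E) ->
    contraction A H -> contraction B G ->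
  hproj D T = hproj A H *t hproj B G /\ contraction D T.
Proof.
move=> EE EA EH [AP PA PP] [BQ QB QQ]; set P := hproj A H in T AP PA PP *.
(* [A H] and [H A] are products of two odd matrices, hence even. *)
have EP : E *m P = P *m E.
  rewrite /P /hproj mulmxBr mulmxBl mulmxDr mulmxDl !mulmxA EA EH.
  by rewrite !mulNmx -!mulmxA EA EH !mulmxN !opprK mulmx1 mul1mx.
have hE : hproj D T = P *t hproj B G.
  have DT : D *m T = (A *m H) *t 1%:M + (E *m H) *t B + P *t (B *m G).
    rewrite mulmxDl !mulmxDr !tensmx_mul !mul1mx !mulmx1 !mulmxA AP mul0mx.
    by rewrite tens0mx addr0 EP -(mulmxA P) EE mulmx1 addrA.
  have TD : T *m D = (H *m A) *t 1%:M + (H *m E) *t B + P *t (G *m B).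
    rewrite mulmxDl !mulmxDr !tensmx_mul !mul1mx !mulmx1 -!mulmxA EA EE.
    by rewrite !mulmxN mulmxA PA mul0mx oppr0 tens0mx add0r mulmx1.
  rewrite {1}/hproj DT TD EH -tensmx11.
  have -> : - (H *m E) *t B = - ((H *m E) *t B).
    by apply/matrixP=> i j; rewrite !mxE mulNr.
  have P1 : P *t 1%:M = 1%:M *t 1%:M - ((A *m H) *t 1%:M + (H *m A) *t 1%:M)
      :> 'M_(m * n).
    by rewrite -tensmxDl -tensmxBl.
  rewrite tensmxBr tensmxDr P1 -[RHS]addrA -opprD; congr (_ - _).
  by rewrite addrACA [X in X + _]addrACA addNr addr0.
rewrite /contraction !hE; split=> //; split.
- by rewrite mulmxDl !tensmx_mul AP EP BQ mul1mx tens0mx tensmx0 addr0.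
- by rewrite mulmxDr !tensmx_mul PA QB mulmx1 tens0mx tensmx0 addr0.
- by rewrite tensmx_mul PP QQ.
Qed.

(** * Boundary matrices *)

(** The rank factorization writes the map as a surjection onto a space of dimension [\rank A]
    followed by an injection. *)
Lemma dim_limg_mulmxr (F : fieldType) m n (A : 'M[F]_(m, n)) :
  \dim (limg (linfun (mulmxr A) : 'Hom('rV_m, 'rV_n))) = \rank A.
Proof.
pose f : 'Hom('rV_m, 'rV_(\rank A)) := linfun (mulmxr (col_base A)).
pose g : 'Hom('rV_(\rank A), 'rV_n) := linfun (mulmxr (row_base A)).
have -> : linfun (mulmxr A) = (g \o f)%VF :> 'Hom('rV_m, 'rV_n).
  by apply/lfunP=> v; rewrite comp_lfunE !lfunE /= -mulmxA mulmx_base.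
have [B cB] := row_fullP (col_base_full A).
have [C rC] := row_freeP (row_base_free A).
have -> : limg (g \o f) = (g @: fullv)%VS.
  rewrite limg_comp; congr (_ @: _)%VS; apply/vspaceP=> v; rewrite memvf.
  apply/memv_imgP; exists (v *m B); rewrite ?memvf //.
  by rewrite lfunE /= -mulmxA cB mulmx1.
rewrite limg_dim_eq ?dimvf ?dim_matrix ?mul1r //.
apply/eqP; rewrite -subv0; apply/subvP=> v; rewrite capfv memv_ker lfunE /=.
by move/eqP=> vg; rewrite memv0 -[v]mulmx1 -rC mulmxA vg mul0mx.
Qed.

Section Chains.

Variables (F : fieldType) (T : finType).
Implicit Types (s t : {set T}) (S K : {set {set T}}) (c : chain F T).

Local Notation "''b_' s" := (basis_chain F s) (at level 3, s at level 2).

Lemma chain_basisE c : c = \sum_s c s *: 'b_s.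
Proof.
apply/ffunP=> t; rewrite sum_ffunE (bigD1 t) //= big1 => [|s /negPf st].
  by rewrite !ffunE eqxx addr0; exact/esym/mulr1.
by rewrite !ffunE eq_sym st; exact: mulr0.
Qed.

(** An ungraded counterpart of [chains]: all degrees are kept together, so that a single square-zero
    matrix carries the whole homology. *)
Definition support_space S : {vspace chain F T} :=
  <<[seq 'b_s | s : {set T} in S]>>%VS.

Lemma mem_support_space S c :
  reflect (forall s, s \notin S -> c s = 0) (c \in support_space S).
Proof.
apply: (iffP idP) => [cS s sS|c0].
  rewrite (coord_span cS) sum_ffunE big1 // => i _; rewrite ffunE.
  have /mapP[t] : [seq 'b_s | s in S]`_i \in [seq 'b_s | s in S].
    by rewrite mem_nth ?size_image ?ltn_ord.
  rewrite mem_enum => tS ->; rewrite ffunE.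
  by case: eqP => [st|_]; [rewrite st tS in sS | exact: mulr0].
rewrite (chain_basisE c); apply: memv_suml => s _.
have [sS|/c0->] := boolP (s \in S); last by rewrite scale0r mem0v.
by apply/memvZ/memv_span/map_f; rewrite mem_enum.
Qed.

Lemma support_space_sub S S' :
  S \subset S' -> (support_space S <= support_space S')%VS.
Proof.
move/subsetP=> SS'; apply/subvP=> c /mem_support_space c0.
by apply/mem_support_space=> s sS'; apply: c0; apply: contra sS'; exact: SS'.
Qed.

Lemma boundary_basis s :
  boundary F T 'b_s = \sum_(x in s) (-1) ^+ face_pos s x *: 'b_(s :\ x).
Proof.
rewrite lfunE /= /boundary_fun (bigD1 s) //= [X in _ + X]big1 => [|t /negPf ts].
  by rewrite ffunE eqxx scale1r addr0.
by rewrite ffunE ts scale0r.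
Qed.

Definition bcoef s t : F := boundary F T 'b_s t.

Lemma bcoefE s t :
  bcoef s t = \sum_(x in s) (-1) ^+ face_pos s x * (t == s :\ x)%:R.
Proof.
rewrite /bcoef boundary_basis sum_ffunE.
by apply: eq_bigr => x _; rewrite !ffunE.
Qed.

Lemma bcoef_neq0 s t : bcoef s t != 0 -> t \subset s /\ #|s| = #|t|.+1.
Proof.
rewrite bcoefE => /eqP b0.
have [/existsP[x /andP[xs /eqP->]]|/existsPn nx] :=
    boolP [exists x, (x \in s) && (t == s :\ x)].
  by rewrite subD1set (cardsD1 x s) xs.
case: b0; apply: big1 => x xs; have := nx x; rewrite xs /= => /negPf->.
by rewrite mulr0.
Qed.

Lemma boundaryE c t : boundary F T c t = \sum_s c s * bcoef s t.
Proof.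
rewrite {1}(chain_basisE c) linear_sum sum_ffunE; apply: eq_bigr => s _.
by rewrite linearZ ffunE.
Qed.

Lemma face_posD1 s x y : x \in s ->
  face_pos s y = ((enum_rank x < enum_rank y)%N + face_pos (s :\ x) y)%N.
Proof.
move=> xs; rewrite /face_pos (cardsD1 x) inE xs; congr (_ + _)%N.
by apply: eq_card => z; rewrite !inE andbA.
Qed.

(** Deleting the earlier of two vertices shifts the position of the later one by exactly one, while
    deleting the later does not move the earlier. The two orders of deletion thus carry opposite
    signs. *)
Lemma boundary_boundary c : boundary F T (boundary F T c) = 0.
Proof.
rewrite (chain_basisE c) !linear_sum big1 // => s _; rewrite !linearZ /=.
rewrite boundary_basis linear_sum.
pose f x y := (-1) ^+ (face_pos s x + face_pos (s :\ x) y) *: 'b_(s :\ x :\ y).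
pose lt (x y : T) := (enum_rank x < enum_rank y)%N.
rewrite (eq_bigr (fun x => \sum_(y in s | lt y x) f x y
                         + \sum_(y in s | lt x y) f x y)); last first.
  move=> x xs; rewrite linearZ /= boundary_basis scaler_sumr.
  rewrite (bigID (lt^~ x)) /=; congr (_ + _); apply: eq_big => y.
  - rewrite !inE /lt; case: eqP => //= ->; by rewrite ltnn andbF.
  - by rewrite scalerA -exprD.
  - rewrite !inE /lt -leqNgt leq_eqVlt (inj_eq val_inj) (inj_eq enum_rank_inj).
    by rewrite [x == y]eq_sym; case: eqP => //= ->; rewrite ltnn andbF.
  by rewrite scalerA -exprD.
(* Exchanging the sums in the second half pairs each term with the one deleting the same two
   vertices in the other order. *)
rewrite big_split /= [X in _ + X](exchange_big_dep (mem s)) /=; last first.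
  by move=> x y _ /andP[].
rewrite -big_split big1 ?scaler0 //= => x xs.
rewrite xs /= -big_split big1 //= => y.
case/andP=> ys yx; rewrite /f (face_posD1 x ys) (face_posD1 y xs).
rewrite -/(lt y x) -/(lt x y).
rewrite yx /lt ltnNge ltnW // add0n (addnC (face_pos (s :\ x) y)) -addnA exprS.
by rewrite [s :\ y :\ x]setDDl setUC -setDDl mulN1r scaleNr addNr.
Qed.

Definition chain_of_row n (e : 'I_n -> {set T}) (v : 'rV[F]_n) : chain F T :=
  \sum_i v 0 i *: 'b_(e i).

Fact chain_of_row_is_linear n (e : 'I_n -> {set T}) : linear (chain_of_row e).
Proof.
move=> a u v; rewrite /chain_of_row scaler_sumr -big_split /=.
by apply: eq_bigr => i _; rewrite !mxE scalerDl scalerA.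
Qed.

HB.instance Definition _ n (e : 'I_n -> {set T}) :=
  GRing.isLinear.Build F 'rV[F]_n (chain F T) *:%R (chain_of_row e)
    (chain_of_row_is_linear e).

(* Faces are listed by an arbitrary injective [e], so that the pair enumeration
   of a join yields a tensor expression with no reindexing permutation. *)
Definition bmx n (e : 'I_n -> {set T}) : 'M[F]_n :=
  \matrix_(i, j) bcoef (e i) (e j).

(** A full subcomplex on [J] misses the singletons outside [J], so in general it is not a [complex]
    on [T]; the homology lemmas rest on this property instead. *)
Definition down_closed K := forall s t, t \in K -> s \subset t -> s \in K.

Section Enumerated.

Variables (n : nat) (e : 'I_n -> {set T}) (S : {set {set T}}).
Hypotheses (e_inj : injective e) (eS : forall s, (s \in S) = (s \in codom e)).

Lemma chain_of_rowE v i : chain_of_row e v (e i) = v 0 i.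
Proof.
rewrite sum_ffunE (bigD1 i) //= big1 => [|j /negPf ji].
  by rewrite !ffunE eqxx addr0; exact: mulr1.
by rewrite !ffunE (inj_eq e_inj) eq_sym ji; exact: mulr0.
Qed.

Lemma chain_of_row_out v s : s \notin S -> chain_of_row e v s = 0.
Proof.
rewrite eS => se; rewrite sum_ffunE big1 // => i _; rewrite !ffunE.
by case: eqP => [si|_]; [rewrite si codom_f in se | exact: mulr0].
Qed.

Lemma chain_of_row_inj : injective (chain_of_row e).
Proof.
move=> u v uv; apply/rowP=> i.
by rewrite -chain_of_rowE uv chain_of_rowE.
Qed.

Let phi : 'Hom('rV[F]_n, chain F T) := linfun (chain_of_row e).

Lemma lker_chain_of_row : lker phi == 0%VS.
Proof. by apply/lker0P=> u v; rewrite !lfunE; exact: chain_of_row_inj. Qed.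

Lemma limg_chain_of_row : limg phi = support_space S.
Proof.
apply/vspaceP=> c; apply/memv_imgP/mem_support_space => [[v _ ->] s sS|c0].
  by rewrite lfunE /= chain_of_row_out.
exists (\row_i c (e i)); rewrite ?memvf // lfunE /=; apply/ffunP=> s.
have [|sS] := boolP (s \in S); last by rewrite chain_of_row_out ?c0.
by rewrite eS => /codomP[i ->]; rewrite chain_of_rowE mxE.
Qed.

Lemma card_enumerated : #|S| = n.
Proof. by rewrite (eq_card eS) card_codom // card_ord. Qed.

Lemma dim_support_space_enum : \dim (support_space S) = n.
Proof.
rewrite -limg_chain_of_row limg_dim_eq ?dimvf ?dim_matrix ?mul1r //.
by rewrite (eqP lker_chain_of_row) capv0.
Qed.

Hypothesis S_closed : down_closed S.

Lemma boundary_chain_of_row v :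
  boundary F T (chain_of_row e v) = chain_of_row e (v *m bmx e).
Proof.
apply/ffunP=> s; rewrite linear_sum sum_ffunE.
have [|sS] := boolP (s \in S).
  rewrite eS => /codomP[j ->]; rewrite chain_of_rowE mxE.
  by apply: eq_bigr => i _; rewrite linearZ ffunE mxE.
(* Outside [S] both sides vanish: a nonzero coefficient at [s] would make [s] a subset of some
   [e i], hence a member of [S]. *)
rewrite chain_of_row_out // big1 // => i _; rewrite linearZ ffunE -/(bcoef _ _).
have [->|/bcoef_neq0[sub _]] := eqVneq (bcoef (e i) s) 0; first exact: mulr0.
by rewrite (S_closed _ sub) ?eS ?codom_f in sS.
Qed.

Lemma bmx_square : bmx e *m bmx e = 0.
Proof.
apply/row_matrixP=> i; apply: chain_of_row_inj.
rewrite row0 rowE mulmxA -!boundary_chain_of_row boundary_boundary.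
by rewrite linear0.
Qed.

Lemma dim_boundary_support :
  \dim (boundary F T @: support_space S) = \rank (bmx e).
Proof.
rewrite -limg_chain_of_row -limg_comp.
have -> : (boundary F T \o phi)%VF = (phi \o linfun (mulmxr (bmx e)))%VF.
  by apply/lfunP=> v; rewrite !comp_lfunE !lfunE /= -boundary_chain_of_row lfunE.
rewrite limg_comp limg_dim_eq ?dim_limg_mulmxr //.
by rewrite (eqP lker_chain_of_row) capv0.
Qed.

End Enumerated.

Definition face_enum S (i : 'I_#|S|) : {set T} := enum_val i.

Lemma face_enum_inj S : injective (@face_enum S).
Proof. exact: enum_val_inj. Qed.

Lemma mem_face_enum S s : (s \in S) = (s \in codom (@face_enum S)).
Proof.
apply/idP/codomP=> [sS|[i ->]]; last exact: enum_valP.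
by exists (enum_rank_in sS s); rewrite /face_enum enum_rankK_in.
Qed.

Lemma dim_support_space S : \dim (support_space S) = #|S|.
Proof. exact: dim_support_space_enum (@face_enum_inj S) (mem_face_enum S). Qed.

(** * The grading and the total Betti number *)

Definition graded K k := [set s in K | #|s| == k].

Lemma chainsE K k : chains F K k = support_space (graded K k).
Proof. by []. Qed.

Lemma boundary_graded K k c : down_closed K ->
  c \in support_space (graded K k.+1) ->
  boundary F T c \in support_space (graded K k).
Proof.
move=> clK /mem_support_space c0; apply/mem_support_space => t.
rewrite boundaryE inE => tK; apply: big1 => s _.
have [sK|/c0->] := boolP (s \in graded K k.+1); last by rewrite mul0r.
have [->|/bcoef_neq0[ts st]] := eqVneq (bcoef s t) 0; first by rewrite mulr0.
move: sK tK; rewrite inE st eqSS => /andP[sK ->].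
by rewrite (clK _ _ sK ts).
Qed.

Lemma boundaries_sub_cycles K k : down_closed K ->
  (boundaries F K k <= cycles F K k)%VS.
Proof.
move=> clK; apply/subvP=> _ /memv_imgP[c cK ->].
by rewrite memv_cap memv_ker boundary_boundary eqxx andbT boundary_graded.
Qed.

Lemma dim_boundary_graded K : down_closed K ->
  \dim (boundary F T @: support_space K) =
  (\sum_(k < #|T|.+1) \dim (boundary F T @: chains F K k))%N.
Proof.
move=> clK.
have -> : support_space K = (\sum_(k < #|T|.+1) chains F K k)%VS.
  apply/eqP; rewrite eqEsubv; apply/andP; split; last first.
    apply/subv_sumP=> k _; apply: support_space_sub.
    by apply/subsetP=> s; rewrite inE => /andP[].
  apply/span_subvP=> _ /mapP[s sK ->]; rewrite mem_enum in sK.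
  have sT : (#|s| < #|T|.+1)%N by rewrite ltnS max_card.
  apply: (subvP (sumv_sup (Ordinal sT) _ (subvv _))) => //.
  by apply/memv_span/map_f; rewrite mem_enum inE sK eqxx.
rewrite limg_sum; apply/directvP/directv_sum_independent=> u uB u0 k _.
apply/ffunP=> t; rewrite [RHS]ffunE.
(* Only sets with [#|t|.+1] elements have [t] in their boundary, so at most one summand is nonzero
   at [t]; this gives independence of the images. *)
have supp (j : 'I__) : (#|t|.+1 != j)%N -> u j t = 0.
  move=> tj; have /memv_imgP[c cK ->] := uB j isT.
  rewrite boundaryE big1 // => s _.
  move/mem_support_space: cK => /(_ s); rewrite inE.
  have [->|/bcoef_neq0[_ st]] := eqVneq (bcoef s t) 0; first by rewrite mulr0.
  by rewrite st (negPf tj) andbF => -> //; rewrite mul0r.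
have [tk|/supp//] := eqVneq #|t|.+1 (k : nat).
move/ffunP/(_ t): u0; rewrite sum_ffunE (bigD1 k) //= big1 ?addr0 => [->|j jk].
  by rewrite ffunE.
by apply: supp; rewrite tk eq_sym (inj_eq val_inj).
Qed.

Definition total_betti K := (\sum_(k < #|T|.+1) rbetti F K k)%N.

(** Rank-nullity in each degree counts the faces with [k] vertices as the Betti number plus the
    ranks of the incoming and outgoing boundaries; summed over [k], every rank occurs twice. *)
Lemma total_betti_boundary K : down_closed K ->
  (total_betti K + 2 * \dim (boundary F T @: support_space K))%N = #|K|.
Proof.
move=> clK; pose r k : nat := \dim (boundary F T @: chains F K k).
have bettiE k : (rbetti F K k + r k.+1 + r k)%N = #|graded K k|.
  (* The truncated subtraction in [rbetti] is exact because boundaries are cycles. *)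
  rewrite subnK ?dimvS ?boundaries_sub_cycles //.
  by rewrite limg_ker_dim chainsE dim_support_space.
have r0 : r 0%N = 0%N.
  apply/eqP; rewrite /r dimv_eq0 -subv0 limg_span; apply/span_subvP.
  move=> _ /mapP[_ /mapP[s + ->] ->]; rewrite mem_enum inE cards_eq0.
  by case/andP=> _ /eqP->; rewrite boundary_basis big_set0 mem0v.
have rT : r #|T|.+1 = 0%N.
  rewrite /r chainsE; suff -> : graded K #|T|.+1 = set0.
    by rewrite /support_space /image_mem enum_set0 /= span_nil limg0 dimv0.
  apply/setP=> s; rewrite !inE; apply: contraTF (max_card (mem s)).
  move=> /andP[_ /eqP->].
  by rewrite ltnn.
(* Both end terms vanish, so the shifted sum has the same value. *)
have shift : (\sum_(k < #|T|.+1) r k.+1 = \sum_(k < #|T|.+1) r k)%N.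
  have := big_ord_recr #|T|.+1 (fun i => r i) : (\sum_(i < _) _ = _)%N.
  by rewrite big_ord_recl /= r0 add0n rT addn0.
have -> : #|K| = (\sum_(k < #|T|.+1) #|graded K k|)%N.
  rewrite -[LHS]sum1_card.
  pose ord_card (s : {set T}) : 'I_#|T|.+1 := inord #|s|.
  rewrite (partition_big ord_card predT) //=.
  apply: eq_bigr => k _; rewrite -[RHS]sum1_card; apply: eq_bigl => s.
  by rewrite inE -val_eqE /= inordK // ltnS max_card.
rewrite dim_boundary_graded // -/r mul2n -addnn addnA -{1}shift -!big_split /=.
by apply: eq_bigr => k _; exact: bettiE.
Qed.

(** Either side, increased by twice the rank of the boundary matrix, counts the faces. The rank is
    therefore the same for every enumeration and every contraction, which allows a join to be listed
    by pairs. *)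
Lemma rank_hproj_bmx n (e : 'I_n -> {set T}) K (H : 'M_n) :
    injective e -> (forall s, (s \in K) = (s \in codom e)) -> down_closed K ->
  contraction (bmx e) H -> \rank (hproj (bmx e) H) = total_betti K.
Proof.
move=> e_inj eK clK /(dim_contraction (bmx_square e_inj eK clK)) nE.
apply: (@addnI (2 * \rank (bmx e))); rewrite -nE.
rewrite -(dim_boundary_support e_inj eK clK).
by rewrite addnC total_betti_boundary // (card_enumerated e_inj eK).
Qed.

End Chains.

(** * Homology of joins and cones *)

Section SignMatrix.

Variables (F : fieldType) (T : finType) (K : {set {set T}}).

Definition sign_mx : 'M[F]_#|K| :=
  \matrix_(i, j) ((i == j)%:R * (-1) ^+ #|face_enum i|).

Lemma mul_sign_mx n (A : 'M_(_, n)) :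
  sign_mx *m A = \matrix_(i, j) ((-1) ^+ #|face_enum i| * A i j).
Proof.
apply/matrixP=> i j; rewrite !mxE (bigD1 i) //= big1 ?addr0 => [|k /negPf ki].
  by rewrite mxE eqxx mul1r.
by rewrite mxE eq_sym ki !mul0r.
Qed.

Lemma mulmx_sign n (A : 'M_(n, _)) :
  A *m sign_mx = \matrix_(i, j) (A i j * (-1) ^+ #|face_enum j|).
Proof.
apply/matrixP=> i j; rewrite !mxE (bigD1 j) //= big1 ?addr0 => [|k /negPf ki].
  by rewrite mxE eqxx mul1r.
by rewrite mxE ki mul0r mulr0.
Qed.

Lemma sign_mx_square : sign_mx *m sign_mx = 1%:M.
Proof.
rewrite mul_sign_mx; apply/matrixP=> i j; rewrite !mxE.
by case: eqP => [->|]; rewrite ?mul0r ?mulr0 // mul1r -expr2 sqrr_sign.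
Qed.

Let A : 'M[F]_#|K| := bmx F (@face_enum T K).

(** A nonzero boundary coefficient links faces whose numbers of vertices differ by one. *)
Lemma sign_mx_bmx : sign_mx *m A = - (A *m sign_mx).
Proof.
rewrite mul_sign_mx mulmx_sign; apply/matrixP=> i j; rewrite !mxE.
have [->|/bcoef_neq0[_ ->]] := eqVneq (bcoef F (face_enum i) (face_enum j)) 0.
  by rewrite mulr0 mul0r oppr0.
by rewrite exprS mulN1r mulNr mulrC.
Qed.

Lemma sign_mx_char2 : 2%:R == 0 :> F -> sign_mx = 1%:M.
Proof.
move=> two0; have N1 : -1 = 1 :> F.
  by apply/eqP; rewrite eq_sym -addr_eq0.
by apply/matrixP=> i j; rewrite !mxE N1 expr1n mulr1.
Qed.

End SignMatrix.

Section Kunneth.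

Variables (F : fieldType) (T U : finType).
Implicit Types (s : {set T}) (t : {set U}).

Definition sumset s t : {set T + U} := inl @: s :|: inr @: t.

Lemma mem_sumset_inl s t x : (inl x \in sumset s t) = (x \in s).
Proof.
rewrite inE mem_imset; last by move=> ? ? [].
by case: imsetP => [[]|_]; rewrite ?orbF.
Qed.

Lemma mem_sumset_inr s t y : (inr y \in sumset s t) = (y \in t).
Proof.
rewrite inE orbC mem_imset; last by move=> ? ? [].
by case: imsetP => [[]|_]; rewrite ?orbF.
Qed.

Definition mem_sumset := (mem_sumset_inl, mem_sumset_inr).

Lemma sumset_subset s s' t t' :
  (sumset s t \subset sumset s' t') = (s \subset s') && (t \subset t').
Proof.
apply/subsetP/andP=> [sub|[/subsetP ss /subsetP tt] [z|z]].
- by split; apply/subsetP=> z zs; [have := sub (inl z) | have := sub (inr z)];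
    rewrite !mem_sumset; exact.
- by rewrite !mem_sumset; exact: ss.
- by rewrite !mem_sumset; exact: tt.
Qed.

Lemma sumset_eq s s' t t' :
  (sumset s t == sumset s' t') = (s == s') && (t == t').
Proof. by rewrite !eqEsubset !sumset_subset andbACA. Qed.

Lemma sumset_preim (w : {set T + U}) : w = sumset (inl @^-1: w) (inr @^-1: w).
Proof. by apply/setP=> [[z|z]]; rewrite mem_sumset inE. Qed.

Lemma sumsetD1_inl s t x : sumset s t :\ inl x = sumset (s :\ x) t.
Proof. by apply/setP=> [[z|z]]; rewrite inE !mem_sumset !inE. Qed.

Lemma sumsetD1_inr s t y : sumset s t :\ inr y = sumset s (t :\ y).
Proof. by apply/setP=> [[z|z]]; rewrite inE !mem_sumset !inE. Qed.

Lemma card_sumset s t : #|sumset s t| = (#|s| + #|t|)%N.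
Proof.
rewrite cardsU !card_imset; try by move=> ? ? [].
suff -> : inl @: s :&: inr @: t = set0 by rewrite cards0 subn0.
apply/setP=> z; rewrite !inE; apply/negbTE/negP=> /andP[/imsetP[x _ ->]].
by case/imsetP.
Qed.

Lemma mem_join_faces (K : {set {set T}}) (L : {set {set U}}) s t :
  (sumset s t \in join_faces K L) = (s \in K) && (t \in L).
Proof.
apply/imset2P/andP=> [[s' t' sK tL /eqP]|[sK tL]]; last by exists s t.
by rewrite sumset_eq => /andP[/eqP-> /eqP->].
Qed.

Lemma enum_sumE : enum {: T + U} = map inl (enum T) ++ map inr (enum U).
Proof. by rewrite !enumT [in LHS]unlock. Qed.

Lemma index_enum_rank (V : finType) (x : V) : index x (enum V) = enum_rank x.
Proof.
rewrite -[x in LHS](nth_enum_rank x).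
by rewrite index_uniq ?enum_uniq -?cardE ?ltn_ord.
Qed.

Lemma enum_rank_inl (x : T) : enum_rank (inl x : T + U) = enum_rank x :> nat.
Proof.
rewrite -!index_enum_rank enum_sumE index_cat mem_map; last by move=> ? ? [].
by rewrite mem_enum index_map // => ? ? [].
Qed.

Lemma enum_rank_inr (y : U) :
  enum_rank (inr y : T + U) = (#|T| + enum_rank y)%N :> nat.
Proof.
rewrite -!index_enum_rank enum_sumE index_cat; case: ifP => [/mapP[]//|_].
by rewrite size_map -cardE index_map // => ? ? [].
Qed.

Lemma face_pos_inl s t x : face_pos (sumset s t) (inl x) = face_pos s x.
Proof.
(* No vertex of [U] precedes [inl x], so the set being counted is a [sumset] with empty second
   component. *)
rewrite /face_pos -[RHS]addn0 -(cards0 U) -card_sumset.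
congr #|pred_of_set _|; apply/setP=> [[z|z]].
  by rewrite [RHS]mem_sumset_inl [LHS]inE [RHS]inE mem_sumset !enum_rank_inl.
rewrite [RHS]mem_sumset_inr [LHS]inE [RHS]inE mem_sumset_inr.
rewrite enum_rank_inl enum_rank_inr.
by rewrite ltnNge ltnW ?andbF // ltn_addr.
Qed.

(** The enumeration of [T + U] lists [T] first, so all of [s] precedes [inr y]. This is the source
    of the sign [(-1) ^+ #|s|]. *)
Lemma face_pos_inr s t y :
  face_pos (sumset s t) (inr y) = (#|s| + face_pos t y)%N.
Proof.
rewrite /face_pos -card_sumset; congr #|pred_of_set _|; apply/setP=> [[z|z]].
  rewrite [RHS]mem_sumset_inl [LHS]inE [RHS]inE mem_sumset.
  rewrite enum_rank_inl enum_rank_inr.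
  by rewrite ltn_addr ?andbT.
rewrite [RHS]mem_sumset_inr [LHS]inE [RHS]inE mem_sumset.
by rewrite !enum_rank_inr ltn_add2l.
Qed.

(** This is the signed Leibniz rule in coordinates: the deleted vertex lies either in [s] or in
    [t]. *)
Lemma bcoef_sumset s t s' t' :
  bcoef F (sumset s t) (sumset s' t') =
  bcoef F s s' * (t == t')%:R + (s == s')%:R * (-1) ^+ #|s| * bcoef F t t'.
Proof.
rewrite !bcoefE big_sumType /=; congr (_ + _).
  rewrite mulr_suml; apply: eq_big => [x|x _]; first exact: mem_sumset_inl.
  rewrite face_pos_inl sumsetD1_inl sumset_eq -mulrA -natrM mulnb.
  by rewrite [t' == t]eq_sym.
rewrite mulr_sumr; apply: eq_big => [x|x _]; first exact: mem_sumset_inr.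
rewrite face_pos_inr sumsetD1_inr sumset_eq -mulnb natrM exprD.
by rewrite [s' == s]eq_sym !mulrA; congr (_ * _); rewrite mulrC !mulrA.
Qed.

Variables (K : {set {set T}}) (L : {set {set U}}).

Definition enum_join (i : 'I_(#|K| * #|L|)) : {set T + U} :=
  sumset (face_enum (mxtens_unindex i).1) (face_enum (mxtens_unindex i).2).

Lemma enum_join_inj : injective enum_join.
Proof.
move=> i j; case: (mxtens_indexP i) => a b; case: (mxtens_indexP j) => c d /eqP.
rewrite /enum_join !mxtens_indexK sumset_eq /= => /andP[/eqP ac /eqP bd].
by rewrite (face_enum_inj ac) (face_enum_inj bd).
Qed.

Lemma mem_codom_enum_join w : (w \in join_faces K L) = (w \in codom enum_join).
Proof.
rewrite [w]sumset_preim mem_join_faces.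
apply/andP/codomP=> [[wK wL]|[i /eqP]].
  exists (mxtens_index (enum_rank_in wK (inl @^-1: w),
                        enum_rank_in wL (inr @^-1: w))).
  by rewrite /enum_join mxtens_indexK /face_enum /= !enum_rankK_in.
by rewrite sumset_eq => /andP[/eqP-> /eqP->]; split; exact: enum_valP.
Qed.

Lemma bmx_join :
  bmx F enum_join =
  bmx F (@face_enum T K) *t 1%:M + sign_mx F K *t bmx F (@face_enum U L).
Proof.
apply/matrixP=> i j; case: (mxtens_indexP i) => a b.
case: (mxtens_indexP j) => c d; rewrite [in RHS]mxE !tensmxE !mxE.
by rewrite /enum_join !mxtens_indexK bcoef_sumset !(inj_eq (@face_enum_inj _ _)).
Qed.

Lemma join_faces_closed :
  down_closed K -> down_closed L -> down_closed (join_faces K L).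
Proof.
move=> clK clL w v; rewrite [w]sumset_preim [v]sumset_preim !mem_join_faces.
rewrite sumset_subset => /andP[vK vL] /andP[wK wL].
by rewrite (clK _ _ vK wK) (clL _ _ vL wL).
Qed.

(** Since the empty face counts as a chain, the augmented chain complex of a join is a tensor
    product, and over a field its homology is the tensor product of the homologies. *)
Lemma total_betti_join : down_closed K -> down_closed L ->
  total_betti F (join_faces K L) = (total_betti F K * total_betti F L)%N.
Proof.
move=> clK clL; have clKL := join_faces_closed clK clL.
have AA := bmx_square F (@face_enum_inj T K) (mem_face_enum K) clK.
have BB := bmx_square F (@face_enum_inj U L) (mem_face_enum L) clL.
have [EE EA E2] :=
  And3 (sign_mx_square F K) (sign_mx_bmx F K) (@sign_mx_char2 F T K).
have [H ctrH EH] := contraction_exists AA EE EA E2.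
have [G ctrG _] := contraction_exists BB (sign_mx_square F L) (sign_mx_bmx F L)
  (@sign_mx_char2 F U L).
have [] := contraction_tens EE EA EH ctrH ctrG; rewrite -bmx_join => hE ctr.
rewrite -(rank_hproj_bmx enum_join_inj mem_codom_enum_join clKL ctr) hE.
rewrite mxrank_tens (rank_hproj_bmx (@face_enum_inj _ _) (mem_face_enum K)) //.
by rewrite (rank_hproj_bmx (@face_enum_inj _ _) (mem_face_enum L)).
Qed.

End Kunneth.

Section Cones.

Variables (F : fieldType) (T : finType) (K : {set {set T}}).
Implicit Types s t : {set T}.
Hypothesis clK : down_closed K.

Lemma bcoefD1 s x : x \in s -> bcoef F s (s :\ x) = (-1) ^+ face_pos s x.
Proof.
move=> xs; rewrite bcoefE (bigD1 x) //= eqxx mulr1 big1 ?addr0 // => y.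
case/andP=> ys yx; case: eqP => [sxy|]; last by rewrite mulr0.
by move/setP/(_ x): sxy; rewrite !inE eqxx eq_sym yx xs.
Qed.

(* The boundary is injective on the span of the faces containing the apex. *)
Lemma total_betti_cone x :
  (forall s, s \in K -> x |: s \in K) -> total_betti F K = 0%N.
Proof.
move=> cone; pose S := [set s in K | x \in s].
have dimS : \dim (boundary F T @: support_space F S) = #|S|.
  rewrite limg_dim_eq ?dim_support_space //.
  apply/eqP; rewrite -subv0; apply/subvP=> c.
  rewrite memv_cap memv_ker memv0 => /andP[/mem_support_space cS /eqP c0].
  apply/eqP/ffunP=> s; rewrite [RHS]ffunE.
  have [|/cS//] := boolP (s \in S); rewrite inE => /andP[sK xs].
  (* Among the faces containing [x], only [s] has [s :\ x] in its boundary, so this coefficient of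
     the boundary is [c s] up to sign. *)
  move/ffunP/(_ (s :\ x)): c0; rewrite boundaryE [RHS]ffunE (bigD1 s) //= big1.
    rewrite addr0 bcoefD1 // => /eqP.
    by rewrite mulf_eq0 signr_eq0 orbF => /eqP.
  move=> u us; have [|/cS->] := boolP (u \in S); last by rewrite mul0r.
  rewrite inE => /andP[_ xu]; rewrite bcoefE big1 ?mulr0 // => y yu.
  case: eqP => [sxuy|_]; last by rewrite mulr0.
  have xy : x = y.
    apply/eqP; move/setP/(_ x): sxuy.
    by rewrite !inE eqxx xu andbT /=; case: (x == y).
  by case/eqP: us; rewrite -(setD1K yu) -sxuy -xy setD1K.
(* Adding the apex injects the faces without [x] into those with [x]. *)
have cardK : (#|K| <= 2 * #|S|)%N.
  rewrite mul2n -addnn -(cardsID S K) leq_add //.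
    by rewrite subset_leq_card // subsetIr.
  have inj : {in K :\: S &, injective (fun s => x |: s)}.
    move=> s t; rewrite !inE => /andP[+ sK] /andP[+ tK].
    rewrite sK tK /= => /negPf xs /negPf xt /setP st; apply/setP=> y.
    by have := st y; rewrite !inE; case: eqP => // ->; rewrite xs xt.
  rewrite -(card_in_imset inj) subset_leq_card //.
  apply/subsetP=> _ /imsetP[s + ->]; rewrite !inE eqxx andbT => /andP[_].
  exact: cone.
have sub : (\dim (boundary F T @: support_space F S) <=
            \dim (boundary F T @: support_space F K))%N.
  by apply/dimvS/limgS/support_space_sub/subsetP=> s; rewrite inE => /andP[].
(* Twice the rank of the boundary already reaches [#|K|], which leaves no room for homology. *)
rewrite dimS in sub; have := leq_trans cardK (leq_mul (leqnn 2) sub).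
rewrite -(total_betti_boundary F clK) -[X in (_ <= X)%N]add0n leq_add2r.
by rewrite leqn0 => /eqP.
Qed.

End Cones.

(** * Full subcomplexes and Hochster's sum *)

Section Subcomplexes.

Variable F : fieldType.

Lemma full_subcomplex_closed (T : finType) (K : complex T) J :
  down_closed (full_subcomplex K J).
Proof.
move=> s t; rewrite !inE => /andP[tK tJ] st.
by rewrite (complex_sub tK st) (subset_trans st tJ).
Qed.

Lemma full_subcomplex_join (T U : finType) (K : {set {set T}})
    (L : {set {set U}}) I J :
  full_subcomplex (join_faces K L) (sumset I J) =
  join_faces (full_subcomplex K I) (full_subcomplex L J).
Proof.
apply/setP=> w; rewrite [w]sumset_preim mem_join_faces [LHS]inE mem_join_faces.
by rewrite sumset_subset !in_set andbACA.
Qed.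

Lemma Dtilde_join (T U : finType) (K : complex T) (L : complex U) :
  Dtilde F (sjoin K L) = (Dtilde F K * Dtilde F L)%N.
Proof.
rewrite /Dtilde (reindex (fun IJ : {set T} * {set U} => sumset IJ.1 IJ.2)) /=.
  rewrite [RHS]big_distrlr [RHS]pair_bigA /=; apply: eq_bigr => -[I J] _ /=.
  (* The inner sums over degrees are [total_betti] by definition, so the Kuenneth formula applies
     term by term. *)
  rewrite full_subcomplex_join; apply: total_betti_join.
    exact: full_subcomplex_closed.
  exact: full_subcomplex_closed.
exists (fun w : {set T + U} => (inl @^-1: w, inr @^-1: w)) => [[I J]|w] _ /=.
  by congr (_, _); apply/setP=> z; rewrite inE mem_sumset.
exact/esym/sumset_preim.
Qed.

(** For nonempty [J] any vertex of [J] is an apex, so only [J = set0] contributes, through the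
    homology of the complex whose sole face is empty. *)
Lemma Dtilde_simplex r : Dtilde F (simplex r) = 1%N.
Proof.
rewrite /Dtilde (bigD1 set0) //= -/(total_betti F _) big1 ?addn0; last first.
  move=> J /set0Pn[x xJ]; apply: (@total_betti_cone F _ _ _ x).
    exact: (@full_subcomplex_closed _ (simplex r)).
  by move=> s; rewrite !inE subUset sub1set xJ.
have := total_betti_boundary F (@full_subcomplex_closed _ (simplex r) set0).
have -> : full_subcomplex (simplex r) set0 = [set set0].
  by apply/setP=> s; rewrite !inE subset0.
(* The Betti number plus twice a rank equals 1, so the rank is 0. *)
by rewrite cards1; case: (\dim _) => [|k]; rewrite ?muln0 ?addn0 // mulnS addnC.
Qed.

End Subcomplexes.

(** * Dimensions and tautness *)

Section Dimensions.

Variables (T : finType) (K : complex T).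
Implicit Types s t : {set T}.

Lemma facetP s :
  reflect (s \in faces K /\ forall t, t \in faces K -> s \subset t -> t = s)
          (s \in facets K).
Proof. by rewrite inE; exact: maxsetP. Qed.

Lemma facets_neq0 : exists s, s \in facets K.
Proof.
have [s sK] := @ex_maxset _ (mem (faces K)) (ex_intro _ set0 (complex_set0 K)).
by exists s; rewrite inE.
Qed.

Lemma mdim_facet : exists s, [/\ s \in facets K, mdim K = #|s|%:Z - 1
  & forall t, t \in facets K -> (#|s| <= #|t|)%N].
Proof.
have [s0 s0K] := facets_neq0.
case: (arg_minnP (fun s : {set T} => #|s|) s0K) => s sK smin.
exists s; split=> //; congr (_%:Z - 1); apply/eqP; rewrite eqn_leq.
apply/andP; split.
  exact: (@Order.TotalTheory.bigmin_le_cond _ nat _ #|T| s (mem (facets K))).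
(* The default [#|T|] of the minimum must be compared with [#|s|] as well. *)
elim/big_rec: _ => [|t m tK ms]; first exact: max_card.
by rewrite leq_min ms smin.
Qed.

Lemma sdim_face : exists s, [/\ s \in faces K, sdim K = #|s|%:Z - 1
  & forall t, t \in faces K -> (#|t| <= #|s|)%N].
Proof.
have [|s sK smax] := @eq_bigmax_cond _ (mem (faces K)) (fun s => #|s|).
  by apply/card_gt0P; exists set0; exact: complex_set0.
exists s; split=> // [|t tK]; first by rewrite /sdim smax.
by rewrite -smax; exact: leq_bigmax_cond.
Qed.

End Dimensions.

Section JoinDimensions.

Variables (T U : finType) (K : complex T) (L : complex U).
Implicit Types (s : {set T}) (t : {set U}).

Lemma facets_join s t :
  (sumset s t \in facets (sjoin K L)) = (s \in facets K) && (t \in facets L).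
Proof.
apply/facetP/andP=> [[]|[/facetP[sK smax] /facetP[tL tmax]]].
  (* Maximality of each component is tested by enlarging it while the other stays fixed. *)
  rewrite mem_join_faces => /andP[sK tL] stmax; split; apply/facetP; split=> //.
    move=> s' s'K ss'; have := stmax (sumset s' t).
    rewrite mem_join_faces sumset_subset s'K tL ss' subxx => /(_ isT isT) /eqP.
    by rewrite sumset_eq => /andP[/eqP].
  move=> t' t'L tt'; have := stmax (sumset s t').
  rewrite mem_join_faces sumset_subset t'L sK tt' subxx => /(_ isT isT) /eqP.
  by rewrite sumset_eq => /andP[_ /eqP].
split=> [|w]; first by rewrite mem_join_faces sK tL.
rewrite [w]sumset_preim mem_join_faces sumset_subset.
by move=> /andP[wK wL] /andP[sw tw]; rewrite (smax _ wK sw) (tmax _ wL tw).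
Qed.

(** Largest cardinalities of faces add up; the [+ 1] arises because each dimension is a cardinality
    minus one. *)
Lemma sdim_join : sdim (sjoin K L) = sdim K + sdim L + 1.
Proof.
have [s [sK -> smax]] := sdim_face K; have [t [tL -> tmax]] := sdim_face L.
have [w [wKL -> wmax]] := sdim_face (sjoin K L).
have -> : #|w| = (#|s| + #|t|)%N.
  apply/eqP; rewrite eqn_leq -{2}card_sumset wmax ?mem_join_faces ?sK //.
  move: wKL; rewrite [w]sumset_preim mem_join_faces card_sumset andbT.
  by case/andP=> wK wL; rewrite leq_add ?smax ?tmax.
by rewrite PoszD; ring.
Qed.

Lemma mdim_join : mdim (sjoin K L) = mdim K + mdim L + 1.
Proof.
have [s [sK -> smin]] := mdim_facet K; have [t [tL -> tmin]] := mdim_facet L.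
have [w [wKL -> wmin]] := mdim_facet (sjoin K L).
have -> : #|w| = (#|s| + #|t|)%N.
  apply/eqP; rewrite eqn_leq -{1}card_sumset wmin ?facets_join ?sK //=.
  move: wKL; rewrite [w]sumset_preim facets_join card_sumset.
  by case/andP=> wK wL; rewrite leq_add ?smin ?tmin.
by rewrite PoszD; ring.
Qed.

End JoinDimensions.

Lemma sdim_simplex r : sdim (simplex r) = r%:Z - 1.
Proof.
have [s [_ -> /(_ setT)]] := sdim_face (simplex r).
rewrite inE cardsT card_ord => /(_ isT) rs; congr (_%:Z - 1); apply/eqP.
by rewrite eqn_leq rs andbT -[X in (_ <= X)%N]card_ord max_card.
Qed.

Lemma mdim_simplex r : mdim (simplex r) = r%:Z - 1.
Proof.
have [s [/facetP[_ /(_ setT)] ]] := mdim_facet (simplex r).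
by rewrite inE subsetT => /(_ isT isT) <- -> _; rewrite cardsT card_ord.
Qed.

(** * Tautness of joins and simplices *)

(** The nonzero factor [2%:R ^ b] can be cancelled. Over [rat] the exponents may be any integers, so
    their addition needs no sign condition. *)
Lemma natr_pow2_mul (d e : nat) (a b : int) : e%:R = 2%:R ^ b :> rat ->
  d%:R = 2%:R ^ a :> rat <-> (d * e)%:R = 2%:R ^ (a + b) :> rat.
Proof.
move=> eb; have b0 : 2%:R ^ b != 0 :> rat by rewrite expfz_neq0.
by rewrite natrM expfzDr // eb; split=> [->//|/(mulIf b0)].
Qed.

Lemma taut_join (F : fieldType) (T U : finType) (K : complex T)
    (L : complex U) :
  taut F L -> (taut F K <-> taut F (sjoin K L)).
Proof.
move=> tL; rewrite /taut Dtilde_join.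
suff -> : #|{: T + U}|%:Z - sdim (sjoin K L) - 1 =
  (#|T|%:Z - sdim K - 1) + (#|U|%:Z - sdim L - 1) by exact: natr_pow2_mul tL.
by rewrite card_sum PoszD sdim_join; ring.
Qed.

Lemma weakly_taut_join (F : fieldType) (T U : finType) (K : complex T)
    (L : complex U) :
  weakly_taut F L -> (weakly_taut F K <-> weakly_taut F (sjoin K L)).
Proof.
move=> tL; rewrite /weakly_taut Dtilde_join.
suff -> : #|{: T + U}|%:Z - mdim (sjoin K L) - 1 =
  (#|T|%:Z - mdim K - 1) + (#|U|%:Z - mdim L - 1) by exact: natr_pow2_mul tL.
by rewrite card_sum PoszD mdim_join; ring.
Qed.

Lemma taut_simplex (F : fieldType) r : taut F (simplex r).
Proof.
rewrite /taut Dtilde_simplex sdim_simplex card_ord.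
by have -> : r%:Z - (r%:Z - 1) - 1 = 0 by ring.
Qed.

Lemma weakly_taut_simplex (F : fieldType) r : weakly_taut F (simplex r).
Proof.
rewrite /weakly_taut Dtilde_simplex mdim_simplex card_ord.
by have -> : r%:Z - (r%:Z - 1) - 1 = 0 by ring.
Qed.

Theorem lemma5p1 (F : fieldType) (T U : finType)
    (K : complex T) (L : complex U) :
  (taut F L -> (taut F K <-> taut F (sjoin K L))) /\
  (weakly_taut F L -> (weakly_taut F K <-> weakly_taut F (sjoin K L))) /\
  (forall r : nat, (1 <= r)%N ->
     (taut F K <-> taut F (sjoin K (simplex r))) /\
     (weakly_taut F K <-> weakly_taut F (sjoin K (simplex r)))).
Proof.
split; first exact: taut_join.
split; first exact: weakly_taut_join.
move=> r _; split; first exact/taut_join/taut_simplex.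
exact/weakly_taut_join/weakly_taut_simplex.
Qed.
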